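(* Distance optimality and time optimality for Formation Control on Graphs cannot, in general, be simultaneously satisfied: there exists an instance $(G,A,x_I,x_G)$ for which no solution is both distance optimal and time optimal.
   Context: An instance consists of a finite connected undirected simple graph $G=(V,E)$ (each edge has length 1), a set of agents $A=\{a_1,\dots,a_n\}$, $n\ge1$, and injective maps $x_I,x_G:A\to V$ (initial and goal vertices) with $x_I(A)\cap x_G(A)=\emptyset$. A scheduled path is a map $p_i:\{0,1,2,\dots\}\to V$. For a permutation $\sigma$ of the goals, write $\sigma\circ x_G$ for the resulting goal assignment. The path $p_i$ is feasible for $a_i$ (with respect to $\sigma$) if $p_i(0)=x_I(a_i)$, there is a smallest $k_{\min}$ with $p_i(k_{\min})=(\sigma\circ x_G)(a_i)$, $p_i(k)=(\sigma\circ x_G)(a_i)$ for all $k\ge k_{\min}$, and for $0\le k<k_{\min}$ either $(p_i(k),p_i(k+1))\in E$ or $p_i(k)=p_i(k+1)$. Two paths $p_i,p_j$ ($i\ne j$) are in collision if for some $k$ either $p_i(k)=p_j(k)$ or $(p_i(k),p_i(k+1))=(p_j(k+1),p_j(k))$. A solution of the instance is a permutation $\sigma$ together with $P=\{p_1,\dots,p_n\}$, $p_i$ feasible for $a_i$ with respect to this common $\sigma$, no two paths being in collision. Its total distance is the total number of pairs $(i,k)$ with $p_i(k)\ne p_i(k+1)$; it is distance optimal if the total distance is minimum among all solutions. Its convergence time is the time at which the last agent reaches its goal (the maximum of $k_{\min}$ over the agents); it is time optimal if its convergence time is minimum among all solutions. *)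

(* Defs.v *)
(* Plain MathComp. *)
From mathcomp Require Import all_boot all_fingroup.

Set Implicit Arguments.
Unset Strict Implicit.
Unset Printing Implicit Defensive.

(* The agents a_1, ..., a_n are the elements of 'I_n, with n = nb_agents. *)
Record instance := Instance {
  vertex : finType;
  edge : rel vertex;
  edge_sym : symmetric edge;
  edge_irr : irreflexive edge;
  graph_connected : forall u v : vertex, connect edge u v;
  nb_agents : nat;
  nb_agents_ge1 : 1 <= nb_agents;
  x_init : 'I_nb_agents -> vertex;
  x_goal : 'I_nb_agents -> vertex;
  x_init_inj : injective x_init;
  x_goal_inj : injective x_goal;
  init_goal_disjoint : forall a b : 'I_nb_agents, x_init a <> x_goal b
}.

Section FormationControl.

Variable I : instance.

Local Notation V := (vertex I).
Local Notation agent := ('I_(nb_agents I)).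

Definition scheduled_path := nat -> V.

Definition goals : {set V} := [set x_goal a | a : agent].

(* A permutation of the goals is a permutation of V that is the identity
   outside the goal set. *)
Definition goal_perm (sigma : {perm V}) : Prop := perm_on goals sigma.

Definition goal_of (sigma : {perm V}) (a : agent) : V := sigma (x_goal a).

Definition first_arrival (p : scheduled_path) (g : V) (kmin : nat) : Prop :=
  p kmin = g /\ (forall k, k < kmin -> p k <> g).

Definition feasible (sigma : {perm V}) (a : agent) (p : scheduled_path) : Prop :=
  p 0 = x_init a /\
  exists kmin : nat,
    [/\ first_arrival p (goal_of sigma a) kmin,
        forall k, kmin <= k -> p k = goal_of sigma a
      & forall k, k < kmin -> edge (p k) (p k.+1) \/ p k = p k.+1].

Definition in_collision (p q : scheduled_path) : Prop :=
  exists k : nat, p k = q k \/ (p k, p k.+1) = (q k.+1, q k).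

Definition solution (sigma : {perm V}) (P : agent -> scheduled_path) : Prop :=
  [/\ goal_perm sigma,
      forall a, feasible sigma a (P a)
    & forall a b, a <> b -> ~ in_collision (P a) (P b)].

(* Relational, since the set of moves (a, k) of an arbitrary family of paths
   may be infinite; a solution has exactly one total distance, by
   total_distance_ex and total_distance_uniq. *)
Definition total_distance (P : agent -> scheduled_path) (d : nat) : Prop :=
  exists s : seq (agent * nat),
    [/\ uniq s,
        forall a k, (a, k) \in s <-> P a k <> P a k.+1
      & size s = d].

(* T is the maximum of the first arrival times; a solution has exactly one
   convergence time, by convergence_time_ex and convergence_time_uniq. *)
Definition convergence_time
    (sigma : {perm V}) (P : agent -> scheduled_path) (T : nat) : Prop :=
  (exists a, first_arrival (P a) (goal_of sigma a) T) /\
  (forall a k, first_arrival (P a) (goal_of sigma a) k -> k <= T).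

Definition distance_optimal
    (sigma : {perm V}) (P : agent -> scheduled_path) : Prop :=
  solution sigma P /\
  exists d, total_distance P d /\
    forall sigma' P' d',
      solution sigma' P' -> total_distance P' d' -> d <= d'.

Definition time_optimal
    (sigma : {perm V}) (P : agent -> scheduled_path) : Prop :=
  solution sigma P /\
  exists T, convergence_time sigma P T /\
    forall sigma' P' T',
      solution sigma' P' -> convergence_time sigma' P' T' -> T <= T'.

Lemma first_arrival_uniq p g k l :
  first_arrival p g k -> first_arrival p g l -> k = l.
Proof.
move=> [pk ltk] [pl ltl]; case: (ltngtP k l) => // lt_kl.
- by case: (ltl k lt_kl).
- by case: (ltk l lt_kl).
Qed.

Lemma convergence_time_uniq sigma P T T' :
  convergence_time sigma P T -> convergence_time sigma P T' -> T = T'.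
Proof.
move=> [[a Ha] ub] [[b Hb] ub']; apply/eqP.
by rewrite eqn_leq (ub' _ _ Ha) (ub _ _ Hb).
Qed.

Lemma total_distance_uniq P d d' :
  total_distance P d -> total_distance P d' -> d = d'.
Proof.
move=> [s [us Hs <-]] [t [ut Ht <-]].
apply/perm_size/uniq_perm => // -[a k].
by apply/idP/idP; [move/Hs/Ht | move/Ht/Hs].
Qed.

Lemma kmin_fun sigma P : solution sigma P ->
  exists f : {ffun agent -> nat},
    forall a, first_arrival (P a) (goal_of sigma a) (f a) /\
              forall k, f a <= k -> P a k = goal_of sigma a.
Proof.
case=> _ feas _.
have ex a : exists k, P a k == goal_of sigma a.
  by have [_ [k [[/eqP pk _] _ _]]] := feas a; exists k.
exists [ffun a => ex_minn (ex a)] => a; rewrite ffunE.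
case: ex_minnP => m /eqP pm min_m.
have fa : first_arrival (P a) (goal_of sigma a) m.
  by split=> // k lt_km /eqP /min_m; rewrite leqNgt lt_km.
have [_ [k [fak stay _]]] := feas a.
by split=> //; rewrite (first_arrival_uniq fa fak).
Qed.

Lemma convergence_time_ex sigma P :
  solution sigma P -> exists T, convergence_time sigma P T.
Proof.
move=> /kmin_fun [f Hf]; exists (\max_a f a); split; last first.
  move=> a k fak; have [faf _] := Hf a.
  by rewrite (first_arrival_uniq fak faf); apply: leq_bigmax.
have [|a ->] := @eq_bigmax _ f; last by exists a; case: (Hf a).
by rewrite card_ord; apply: nb_agents_ge1.
Qed.

Lemma total_distance_ex sigma P :
  solution sigma P -> exists d, total_distance P d.
Proof.
move=> /kmin_fun [f Hf].
pose s := [seq x <- [seq (a, k) | a <- enum 'I_(nb_agents I),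
                                  k <- iota 0 (\max_b f b)]
             | P x.1 x.2 != P x.1 x.2.+1].
exists (size s), s; split=> //.
- apply/filter_uniq/allpairs_uniq; rewrite ?enum_uniq ?iota_uniq //.
  by move=> [a k] [b l].
- move=> a k; rewrite mem_filter /=; split=> [/andP[/eqP]//|mv].
  apply/andP; split; first exact/eqP.
  apply/allpairsP; exists (a, k); split; rewrite ?mem_enum ?mem_iota //=.
  rewrite add0n ltnNge; apply/negP => le_k; apply: mv.
  have le_f : f a <= k by apply: leq_trans (leq_bigmax a) le_k.
  have [_ stay] := Hf a.
  by rewrite !stay ?leqW.
Qed.

End FormationControl.

(* Main.v *)
(* Three agents start at leaves 0, 1, 2 of a star with centre 3 and have to
   reach its other leaves 4, 5, 6; the detour 2 - 7 - 8 - 6 is one edge longer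
   than the way through the centre.  Sending everyone through the centre costs
   only 6 moves, but the centre holds one agent at a time, so this takes 4
   steps.  Sending one agent along the detour takes 3 steps, but 7 moves. *)
Require Import Defs.
From mathcomp Require Import all_boot all_fingroup.

Set Implicit Arguments.
Unset Strict Implicit.
Unset Printing Implicit Defensive.

(** Lets finite checks over ordinals be settled by evaluating a closed boolean on plain numbers. *)
Lemma all_iota_ord n (p : pred nat) : all p (iota 0 n) -> forall i : 'I_n, p i.
Proof. by move=> /allP pP i; apply: pP; rewrite mem_iota /=. Qed.

Definition detour_edges : seq (nat * nat) :=
  [:: (0, 3); (1, 3); (2, 3); (3, 4); (3, 5); (3, 6); (2, 7); (7, 8); (8, 6)].

Definition adjacent (u v : nat) : bool :=
  ((u, v) \in detour_edges) || ((v, u) \in detour_edges).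

Definition detour_edge : rel 'I_9 := [rel u v : 'I_9 | adjacent u v].

Lemma detour_edge_sym : symmetric detour_edge.
Proof. by move=> u v; apply: orbC. Qed.

Lemma detour_edge_irr : irreflexive detour_edge.
Proof. by move=> u; apply/negbTE; exact: (@all_iota_ord 9 (fun x => ~~ adjacent x x)). Qed.

Lemma detour_connected (u v : 'I_9) : connect detour_edge u v.
Proof.
have csym : connect_sym detour_edge by apply/sym_connect_sym/detour_edge_sym.
suff to_centre w : connect detour_edge w (inord 3).
  by apply: connect_trans (to_centre u) _; rewrite csym.
have step (x y : 'I_9) : (x == y :> nat) || adjacent x y -> connect detour_edge x y.
  by case/orP=> [/eqP/val_inj -> // | xy]; exact: connect1.
(* Every vertex reaches the centre in at most two steps. Only 7 and 8 need both, passing through 2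
   and 6 respectively. *)
pose mid (x : nat) := if x == 7 then 2 else if x == 8 then 6 else 3.
have mid_lt : mid w < 9 by rewrite /mid; case: ifP => // _; case: ifP.
apply: (@connect_trans _ _ (inord (mid w))); apply: step; rewrite !inordK //.
- by move: (w); apply: (@all_iota_ord 9 (fun x => (x == mid x) || adjacent x (mid x))).
- by move: (w); apply: (@all_iota_ord 9 (fun x => (mid x == 3) || adjacent (mid x) 3)).
Qed.

Definition detour_init (a : 'I_3) : 'I_9 := inord a.
Definition detour_goal (a : 'I_3) : 'I_9 := inord (4 + a).

Lemma detour_initE a : detour_init a = a :> nat.
Proof. by rewrite inordK // (leq_trans (ltn_ord a)). Qed.

Lemma detour_goalE a : detour_goal a = 4 + a :> nat.
Proof. by rewrite inordK // (@leq_trans (4 + 3)) // ltn_add2l. Qed.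

Lemma detour_init_inj : injective detour_init.
Proof. by move=> a b /(congr1 val) /=; rewrite !detour_initE => /val_inj. Qed.

Lemma detour_goal_inj : injective detour_goal.
Proof.
by move=> a b /(congr1 val) /=; rewrite !detour_goalE => /addnI/val_inj.
Qed.

Lemma detour_init_goal a b : detour_init a <> detour_goal b.
Proof.
move=> /(congr1 val) /=; rewrite detour_initE detour_goalE => ab.
by have := ltn_ord a; rewrite ab ltnNge (leq_trans _ (leq_addr _ _)).
Qed.

Definition detour : instance :=
  Instance detour_edge_sym detour_edge_irr detour_connected (isT : 0 < 3)
    detour_init_inj detour_goal_inj detour_init_goal.

(* Agent [a] follows the list [nth [::] r a] and stays at its goal [4 + a] once
   that list is exhausted. *)
Definition route_pos (r : seq (seq nat)) (a k : nat) : nat :=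
  nth (4 + a) (nth [::] r a) k.

Definition route_path (r : seq (seq nat)) (a : 'I_3) : scheduled_path detour :=
  fun k => inord (route_pos r a k).

Definition disjoint_at (r : seq (seq nat)) (a b k : nat) : bool :=
  (route_pos r a k != route_pos r b k) &&
  ((route_pos r a k != route_pos r b k.+1) ||
   (route_pos r a k.+1 != route_pos r b k)).

(* Routes stop just before the goal, hence the test [v != 4 + a]. *)
Definition valid_route (r : seq (seq nat)) (a : nat) : bool :=
  [&& all (fun v => (v < 9) && (v != 4 + a)) (nth [::] r a),
      route_pos r a 0 == a,
      size (nth [::] r a) <= 5,
      all (fun k => adjacent (route_pos r a k) (route_pos r a k.+1)
                    || (route_pos r a k == route_pos r a k.+1))
          (iota 0 (size (nth [::] r a)))
    & all (fun b => (a == b) || all (disjoint_at r a b) (iota 0 5)) (iota 0 3)].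

Definition valid_routes (r : seq (seq nat)) : bool :=
  all (valid_route r) (iota 0 3).

(** The range test in [valid_route] makes [inord] lossless, so positions can be compared as
    numbers. *)
Lemma route_pathE r (a : 'I_3) k : valid_routes r ->
  route_path r a k = route_pos r a k :> nat.
Proof.
move=> /all_iota_ord /(_ a) /and5P[/allP lt9 _ _ _ _]; rewrite inordK //.
rewrite /route_pos; have [lt_k | le_k] := ltnP k (size (nth [::] r a)).
  by case/andP: (lt9 _ (mem_nth (4 + a) lt_k)).
by rewrite nth_default // -detour_goalE.
Qed.

Lemma route_path_late r (a : 'I_3) k :
  size (nth [::] r a) <= k -> route_path r a k = detour_goal a.
Proof. by move=> le_k; rewrite /route_path /route_pos nth_default. Qed.

Lemma route_solution r : valid_routes r -> @solution detour 1%g (route_path r).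
Proof.
move=> rV; split.
- exact: perm_on1.
- move=> a; have /all_iota_ord/(_ a)/and5P[/allP rng /eqP p0 _ /allP stp _] := rV.
  split; first by apply: val_inj; rewrite /= route_pathE // p0 detour_initE.
  have goalE : @goal_of detour 1%g a = detour_goal a by rewrite /goal_of perm1.
  (* The list omits the goal, so its length is the first arrival time. *)
  exists (size (nth [::] r a)); rewrite goalE; split.
  + split=> [|k lt_k]; first exact: route_path_late.
    move/(congr1 val); rewrite /= route_pathE // detour_goalE => eq_g.
    by have /andP[_ /eqP] := rng _ (mem_nth (4 + a) lt_k).
  + exact: route_path_late.
  + move=> k lt_k; have /stp/orP[adj|/eqP eq_k] : k \in iota 0 (size (nth [::] r a)).
    * by rewrite mem_iota.
    * by left; rewrite -!route_pathE in adj.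
    * by right; apply: val_inj; rewrite /= !route_pathE.
- move=> a b ab [k hk].
  have ne_ab : (a == b :> nat) = false by apply/eqP => /val_inj.
  have /all_iota_ord/(_ a)/and5P[_ _ sa _ /all_iota_ord/(_ b)] := rV.
  rewrite ne_ab => /allP nocol.
  have /all_iota_ord/(_ b)/and5P[_ _ sb _ _] := rV.
  (* No list has more than 5 entries: from time 5 on, both agents rest at distinct goals, and the
     earlier times are covered by the evaluated check. *)
  have [lt5 | le5] := ltnP k 5.
    have /nocol/andP[ne1 ne2] : k \in iota 0 5 by rewrite mem_iota.
    case: hk => [/(congr1 val)|[/(congr1 val) e1 /(congr1 val) e2]].
      by rewrite /= !route_pathE //; apply/eqP.
    by move: ne2; rewrite /= !route_pathE // in e1 e2; rewrite e1 e2 !eqxx.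
  have la j : 5 <= j -> route_path r a j = detour_goal a.
    by move=> le_j; rewrite route_path_late // (leq_trans sa).
  have lb j : 5 <= j -> route_path r b j = detour_goal b.
    by move=> le_j; rewrite route_path_late // (leq_trans sb).
  by case: hk => [|[+ _]]; rewrite la ?lb ?leqW // => /detour_goal_inj.
Qed.

(** The agents queue up: agent [a] occupies the centre at time [a + 1] only. *)
Definition central_routes := [:: [:: 0; 3]; [:: 1; 1; 3]; [:: 2; 2; 2; 3]].
Definition split_routes := [:: [:: 0; 3]; [:: 1; 1; 3]; [:: 2; 7; 8]].

Lemma central_distance d :
  @total_distance detour (route_path central_routes) d -> d <= 6.
Proof.
move=> [s [us sP <-]].
(* Agent [a] moves only when it enters the centre, at time [a], and when it leaves it, at time
   [a + 1]. *)
pose moves := [:: (0, 0); (0, 1); (1, 1); (1, 2); (2, 2); (2, 3)].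
rewrite -(size_map (fun x : 'I_3 * nat => (val x.1, x.2))).
apply: (@uniq_leq_size _ _ moves).
  by rewrite map_inj_uniq // => -[a k] [b l] [/= /val_inj -> ->].
move=> _ /mapP[[a k] /sP mv ->] /=; apply: contraT => nin; case: mv.
have [lt4 | ge4] := ltnP k 4; last first.
  have sz : size (nth [::] central_routes a) <= 4.
    exact: (@all_iota_ord 3 (fun a => size (nth [::] central_routes a) <= 4)).
  by rewrite !route_path_late ?(leq_trans sz) ?leqW.
apply: val_inj; rewrite /= !route_pathE //; apply/eqP; move: nin; apply/implyP.
pose rests b l := ((b, l) \notin moves) ==>
  (route_pos central_routes b l == route_pos central_routes b l.+1).
have /(_ a) := @all_iota_ord 3 (fun b => all (rests b) (iota 0 4)) isT.
by move=> /all_iota_ord /(_ (Ordinal lt4)).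
Qed.

Lemma split_time T :
  @convergence_time detour 1%g (route_path split_routes) T -> T <= 3.
Proof.
(* A first arrival after time 3 would leave that agent off its goal at time 3, but no list has more
   than three entries. *)
move=> [[a [_ before]] _]; rewrite leqNgt; apply/negP => /before; apply.
rewrite /goal_of perm1 route_path_late //.
exact: (@all_iota_ord 3 (fun a => size (nth [::] split_routes a) <= 3)).
Qed.

Definition three_step_walk (q0 q1 q2 q3 : nat) : bool :=
  [&& q0 < 3, 3 < q3 < 7, (q0 == q1) || adjacent q0 q1,
      (q1 == q2) || adjacent q1 q2 & (q2 == q3) || adjacent q2 q3].

(** An initial and a goal vertex are at distance at least 2, and their only common neighbour is the
    centre. A walk that avoids it at times 1 and 2 must therefore move in all three steps. *)
Lemma three_step_moves (q0 q1 q2 q3 : 'I_9) :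
  three_step_walk q0 q1 q2 q3 ->
  2 + ((q1 != 3 :> nat) && (q2 != 3 :> nat))
    <= (q0 != q1) + (q1 != q2) + (q2 != q3).
Proof.
pose c (x0 x1 x2 x3 : nat) := three_step_walk x0 x1 x2 x3 ==>
  (2 + ((x1 != 3) && (x2 != 3)) <= (x0 != x1) + (x1 != x2) + (x2 != x3)).
have: all (fun x0 => all (fun x1 => all (fun x2 => all (c x0 x1 x2)
        (iota 0 9)) (iota 0 9)) (iota 0 9)) (iota 0 9) by vm_compute.
move=> /all_iota_ord/(_ q0)/all_iota_ord/(_ q1)/all_iota_ord/(_ q2).
by move=> /all_iota_ord/(_ q3)/implyP.
Qed.

Theorem proposition9 :
  exists I : instance,
    ~ (exists (sigma : {perm vertex I})
              (P : 'I_(nb_agents I) -> scheduled_path I),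
         distance_optimal sigma P /\ time_optimal sigma P).
Proof.
exists detour => -[sigma [P [[sol [d [Pd dmin]]] [_ [T [PT Tmin]]]]]].
have d_le6 : d <= 6.
  have csol : solution _ _ := @route_solution central_routes isT.
  have [d' Hd'] := total_distance_ex csol.
  exact: leq_trans (dmin _ _ _ csol Hd') (central_distance Hd').
have T_le3 : T <= 3.
  have ssol : solution _ _ := @route_solution split_routes isT.
  have [T' HT'] := convergence_time_ex ssol.
  exact: leq_trans (Tmin _ _ _ ssol HT') (split_time HT').
have [gp feas nocol] := sol.
have walk (a : 'I_3) : three_step_walk (P a 0) (P a 1) (P a 2) (P a 3).
  have [P0 [m [arr stay step]]] := feas a.
  have stepk k : (P a k == P a k.+1 :> nat) || adjacent (P a k) (P a k.+1).
    have [/step[adj|->]|le_mk] := ltnP k m; last 1 first.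
    - by rewrite !stay ?eqxx // leqW.
    - by apply/orP; right.
    - by rewrite eqxx.
  have m_le3 : m <= 3 by case: PT => _ /(_ a m arr) /leq_trans; apply.
  rewrite /three_step_walk !stepk P0 /= detour_initE ltn_ord !andbT.
  (* Whatever [sigma] is, it maps goals to goals, so every agent is at one of 4, 5, 6 by time 3. *)
  have : P a 3 \in goals detour.
    rewrite stay // /goal_of (perm_closed _ gp); exact: imset_f.
  by case/imsetP=> b _ -> /=; rewrite detour_goalE -[7]/(4 + 3) ltn_add2l ltn_ord.
have [s [us sP sd]] := Pd.
pose mv (x : 'I_3 * 'I_3) := P x.1 x.2 != P x.1 x.2.+1.
(* The moves made in the first three steps are distinct entries of [s], which has [d] entries. *)
have mv_le : \sum_(a < 3) \sum_(k < 3) (mv (a, k) : nat) <= 6.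
  rewrite pair_bigA /=.
  under eq_bigr do rewrite -surjective_pairing.
  rewrite -big_mkcond /= sum1_card cardE.
  apply: leq_trans d_le6; rewrite -sd.
  rewrite -(size_map (fun x : 'I_3 * 'I_3 => (x.1, val x.2))).
  apply: uniq_leq_size.
    by rewrite map_inj_uniq ?enum_uniq // => -[a k] [b l] [/= -> /val_inj ->].
  by move=> _ /mapP[x + ->]; rewrite mem_enum => /eqP/sP.
(* Each agent makes at least 2 moves. If [a] missed the centre it would make 3, for a total of at
   least 7. *)
have centre a : (P a 1 == 3 :> nat) || (P a 2 == 3 :> nat).
  apply: contraLR mv_le; rewrite negb_or -ltnNge => off.
  have mvE b : \sum_(k < 3) (mv (b, k) : nat)
      = (P b 0 != P b 1) + (P b 1 != P b 2) + (P b 2 != P b 3).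
    by rewrite !big_ord_recr big_ord0.
  have mv_ge b : 2 + (b == a) <= \sum_(k < 3) (mv (b, k) : nat).
    rewrite mvE; apply: leq_trans (three_step_moves (walk b)).
    by rewrite leq_add2l; case: eqP => // ->; rewrite off.
  apply: leq_trans (leq_sum _ (fun b _ => mv_ge b)).
  by rewrite big_split /= sum_nat_const card_ord (bigD1 a) //= eqxx.
(* Three agents have to visit the centre at time 1 or 2. *)
have /injectivePn[a [b ab eq_ab]] : ~~ injectiveb (fun a : 'I_3 => P a 1 == 3 :> nat).
  by apply/injectiveP => /leq_card; rewrite card_bool card_ord.
apply: (nocol a b); first exact/eqP.
(* Agents [a] and [b] agree on being at the centre at time 1: if both are, they meet then; if
   neither is, both are there at time 2. *)
have := centre a; have := centre b; rewrite eq_ab.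
case: (boolP (P b 1 == 3 :> nat)) eq_ab => [/eqP b1 /eqP a1 _ _ | _ _ /= /eqP b2 /eqP a2].
  by exists 1; left; apply: val_inj; rewrite /= a1 b1.
by exists 2; left; apply: val_inj; rewrite /= a2 b2.
Qed.
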